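(* Let $\Sigma=\{a,b\}$ and $L=\{a^nb^n y\mid n>0,\ y\in\Sigma^*\}$. Then $L\in D_1(\text{s-LSTM})$: there exist an s-LSTM over $\Sigma$ with state dimension $k$, and $\mathbf w\in\mathbb{Q}^k$, $\beta\in\mathbb{Q}$, such that for all $x\in\Sigma^*$: $\mathbf w\cdot\mathbf h_{|x|}+\beta>0$ if and only if $x\in L$, where $\mathbf h_{|x|}$ is the final state of the s-LSTM on $x$.
   Context: LSTM: with an embedding $\Sigma\to\mathbb{Q}^{d_x}$, $x_t \mapsto \mathbf{x}_t$, rational matrices $\mathbf W^\bullet,\mathbf U^\bullet$ and rational bias vectors (suppressed in notation but allowed in every affine map), and $\mathbf h_0=\mathbf c_0=\mathbf 0$, $\mathbf f_t = \sigma(\mathbf W^f\mathbf x_t+\mathbf U^f\mathbf h_{t-1})$, $\mathbf i_t = \sigma(\mathbf W^i\mathbf x_t+\mathbf U^i\mathbf h_{t-1})$, $\mathbf o_t = \sigma(\mathbf W^o\mathbf x_t+\mathbf U^o\mathbf h_{t-1})$, $\tilde{\mathbf c}_t = \tanh(\mathbf W^c\mathbf x_t+\mathbf U^c\mathbf h_{t-1})$, $\mathbf c_t = \mathbf f_t\odot\mathbf c_{t-1}+\mathbf i_t\odot\tilde{\mathbf c}_t$, $\mathbf h_t=\mathbf o_t\odot\tanh(\mathbf c_t)$. Saturation: the s-LSTM is the LSTM in which $\sigma$ is replaced by the step function equal to $1$ on positive and $0$ on negative arguments, and $\tanh$ by the sign function with values in $\{-1,0,1\}$; parameters are such that no argument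 of a $\sigma$ is exactly $0$ on any input, so all gates lie in $\{0,1\}$. $D_1(E)$ is the set of languages decided by an encoder of type $E$ followed by a linear threshold decoder $\mathbf d_1(\mathbf h)=\mathbb{1}_{>0}(\mathbf w\cdot\mathbf h+\beta)$ applied to the final state. *)

(* Defs.v *)
From mathcomp Require Import all_boot all_order all_algebra.

Set Implicit Arguments.
Unset Strict Implicit.
Unset Printing Implicit Defensive.

Import Order.TTheory GRing.Theory Num.Theory.
Local Open Scope ring_scope.

Definition language (Sigma : Type) := seq Sigma -> Prop.

(** The affine map [(x, h) |-> W x + U h + b]. *)
Record affine (dx k : nat) := Affine {
  wmx : 'M[rat]_(k, dx);
  umx : 'M[rat]_k;
  bias : 'cV[rat]_k
}.

Definition aff dx k (g : affine dx k) (x : 'cV[rat]_dx) (h : 'cV[rat]_k)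
    : 'cV[rat]_k :=
  wmx g *m x + umx g *m h + bias g.

Record lstm (Sigma : Type) (dx k : nat) := LSTM {
  embed : Sigma -> 'cV[rat]_dx;
  forget_gate : affine dx k;
  input_gate : affine dx k;
  output_gate : affine dx k;
  candidate : affine dx k
}.

Record state (k : nat) := State { cell : 'cV[rat]_k; hidden : 'cV[rat]_k }.

Definition hadamard k (u v : 'cV[rat]_k) : 'cV[rat]_k := map2_mx *%R u v.

(** [sigma] and [th] are the activations standing for the logistic function
    and for tanh, applied coordinatewise. *)
Definition lstm_step (sigma th : rat -> rat) Sigma dx k
    (M : lstm Sigma dx k) (s : state k) (a : Sigma) : state k :=
  let x := embed M a in
  let f := map_mx sigma (aff (forget_gate M) x (hidden s)) in
  let i := map_mx sigma (aff (input_gate M) x (hidden s)) in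
  let o := map_mx sigma (aff (output_gate M) x (hidden s)) in
  let ct := map_mx th (aff (candidate M) x (hidden s)) in
  let c := hadamard f (cell s) + hadamard i ct in
  State c (hadamard o (map_mx th c)).

Definition lstm_run (sigma th : rat -> rat) Sigma dx k
    (M : lstm Sigma dx k) (x : seq Sigma) : state k :=
  foldl (lstm_step sigma th M) (State 0 0) x.

(** The value at 0 is immaterial: [gates_nonzero] excludes it. *)
Definition step (z : rat) : rat := if 0 < z then 1 else 0.

Definition slstm_run Sigma dx k (M : lstm Sigma dx k) (x : seq Sigma)
    : state k :=
  lstm_run step Num.sg M x.

(** No argument of a gate activation vanishes in the saturated run on any
    input; [x] is the part already read and [a] the next letter. *)
Definition gates_nonzero Sigma dx k (M : lstm Sigma dx k) : Prop :=
  forall (x : seq Sigma) (a : Sigma) (j : 'I_k),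
    let h := hidden (slstm_run M x) in
    [/\ aff (forget_gate M) (embed M a) h j 0 != 0,
        aff (input_gate M) (embed M a) h j 0 != 0
      & aff (output_gate M) (embed M a) h j 0 != 0].

(** A type of encoders is given by the maps from words to final states that
    its members compute, in each state dimension. *)
Definition encoder_type (Sigma : Type) :=
  forall k : nat, (seq Sigma -> 'cV[rat]_k) -> Prop.

Definition sLSTM (Sigma : Type) : encoder_type Sigma :=
  fun k e => exists (dx : nat) (M : lstm Sigma dx k),
    gates_nonzero M /\ forall x, e x = hidden (slstm_run M x).

Definition d1 k (w : 'rV[rat]_k) (beta : rat) (h : 'cV[rat]_k) : bool :=
  0 < (w *m h) 0 0 + beta.

Definition D1 Sigma (E : encoder_type Sigma) (L : language Sigma) : Prop :=
  exists (k : nat) (e : seq Sigma -> 'cV[rat]_k),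
    E k e /\
    exists (w : 'rV[rat]_k) (beta : rat), forall x, d1 w beta (e x) <-> L x.

Inductive letter := La | Lb.

Definition anbn_prefix : language letter :=
  fun x => exists (n : nat) (y : seq letter),
    (0 < n)%N /\ x = nseq n La ++ nseq n Lb ++ y.

(* Main.v *)
(** Four cells suffice. The gates see only the signs of the cells; with letters
    encoded as a = 1 and b = -1, cell [s] keeps the first letter, [d] the last
    letter, [c] the difference between the numbers of a's and b's, and [k]
    becomes positive for good once an a follows a b while [c] is positive. When
    [c] returns to 0 after the first letter, its input gate closes, so
    acceptance persists whatever follows. Exactly on the words of the language
    (s, c, k) has signs (1, 0, 0), which the threshold 2 s - c - 2 k > 1 detects.
    All gate arguments are odd integers, hence nonzero. *)
Require Import Defs.
From mathcomp Require Import all_boot all_order all_algebra.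
From mathcomp Require Import ring lra.

Set Implicit Arguments.
Unset Strict Implicit.
Unset Printing Implicit Defensive.

Import Order.TTheory GRing.Theory Num.Theory.
Local Open Scope ring_scope.

Definition letter_sign (a : letter) : rat := if a is La then 1 else -1.

Definition vec4 (s d c k : rat) : 'cV[rat]_4 := \col_i [:: s; d; c; k]`_i.

(** Each row lists the coefficients of the letter, of the four hidden
    coordinates, and the bias. *)
Definition affine_of_rows (rows : seq (seq rat)) : affine 1 4 :=
  Affine (\matrix_(i, j) (nth [::] rows i)`_0)
    (\matrix_(i, j) (nth [::] rows i)`_(j.+1)) (\col_i (nth [::] rows i)`_5).

(** The forget biases overwrite [s] and [d] at each step and let [c] and [k] accumulate. Once [s] is
    positive, the input gate of [c] is open exactly while [c] is positive; at the all-zero start its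
    argument is 1, so the first letter is counted. *)
Definition counter_lstm : lstm letter 1 4 :=
  LSTM (fun a => const_mx (letter_sign a))
    (affine_of_rows [:: [:: 0; 0; 0; 0; 0; -1];
                        [:: 0; 0; 0; 0; 0; -1];
                        [:: 0; 0; 0; 0; 0; 1];
                        [:: 0; 0; 0; 0; 0; 1]])
    (affine_of_rows [:: [:: 0; 0; 0; 0; 0; 1];
                        [:: 0; 0; 0; 0; 0; 1];
                        [:: 0; -2; 0; 2; 0; 1];
                        [:: 2; 0; -2; 2; 0; -5]])
    (affine_of_rows [:: [:: 0; 0; 0; 0; 0; 1];
                        [:: 0; 0; 0; 0; 0; 1];
                        [:: 0; 0; 0; 0; 0; 1];
                        [:: 0; 0; 0; 0; 0; 1]])
    (affine_of_rows [:: [:: 1; 2; 0; 0; 0; 0];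
                        [:: 1; 0; 0; 0; 0; 0];
                        [:: 1; 0; 0; 0; 0; 0];
                        [:: 0; 0; 0; 0; 0; 1]]).

(** Since all output gates stay open, every reachable state has this form. *)
Definition sign_state (s d c k : rat) : state 4 :=
  State (vec4 s d c k) (vec4 (Num.sg s) (Num.sg d) (Num.sg c) (Num.sg k)).

Lemma aff_rowsE rows a s d c k (i : 'I_4) :
  aff (affine_of_rows rows) (const_mx (letter_sign a)) (vec4 s d c k) i 0 =
  let r := nth [::] rows i in
  r`_0 * letter_sign a + (r`_1 * s + r`_2 * d + r`_3 * c + r`_4 * k) + r`_5.
Proof.
by rewrite !mxE big_ord1 !mxE !big_ord_recl big_ord0 !mxE /= addr0 !addrA.
Qed.

Lemma hadamardE n (u v : 'cV[rat]_n) i : hadamard u v i 0 = u i 0 * v i 0.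
Proof. by rewrite mxE. Qed.

Lemma map_cVE n (f : rat -> rat) (u : 'cV[rat]_n) i : map_mx f u i 0 = f (u i 0).
Proof. by rewrite mxE. Qed.

Lemma step_sign_state s d c k a :
  let x := letter_sign a in
  lstm_step step Num.sg counter_lstm (sign_state s d c k) a =
  sign_state (Num.sg (x + 2 * Num.sg s)) x
    (c + step (2 * Num.sg c - 2 * Num.sg s + 1) * x)
    (k + step (2 * x - 2 * Num.sg d + 2 * Num.sg c - 5)).
Proof.
have sgx : Num.sg (letter_sign a) = letter_sign a.
  by case: a; rewrite /= ?sgrN sgr1.
have step1 : step 1 = 1 by [].
have stepN1 : step (-1) = 0 by [].
move=> x; rewrite /lstm_step /=.
set c' := (_ + _ : 'cV_4).
have -> : c' = vec4 (Num.sg (x + 2 * Num.sg s)) x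
    (c + step (2 * Num.sg c - 2 * Num.sg s + 1) * x)
    (k + step (2 * x - 2 * Num.sg d + 2 * Num.sg c - 5)).
  apply/colP => i; rewrite [LHS]mxE !hadamardE !map_cVE !aff_rowsE !mxE.
  case: i => [[|[|[|[|//]]]] ilt] /=;
    rewrite !(mul0r, mul1r, add0r, addr0, step1, stepN1, sgr1, mulr1, sgx) //.
  - by congr (_ + step _ * _); ring.
  - by congr (_ + step _); rewrite /x; ring.
congr State; apply/colP => i; rewrite hadamardE !map_cVE aff_rowsE !mxE.
case: i => [[|[|[|[|//]]]] ilt] /=;
  by rewrite !(mul0r, mul1r, add0r, addr0, step1).
Qed.

Definition run_from (t : state 4) (y : seq letter) : state 4 :=
  foldl (lstm_step step Num.sg counter_lstm) t y.

Lemma run_from_sign_state y s d c k :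
  exists s' d' c' k', run_from (sign_state s d c k) y = sign_state s' d' c' k'.
Proof.
elim: y s d c k => [|a y IHy] s d c k /=; first by exists s, d, c, k.
by rewrite step_sign_state.
Qed.

Lemma sign_state0 : State 0 0 = sign_state 0 0 0 0.
Proof.
by congr State; apply/colP => i; rewrite !mxE;
  case: i => [[|[|[|[|//]]]] ilt]; rewrite /= ?sgr0.
Qed.

Variant sgr_spec (x : rat) : rat -> Type :=
  | SgrN of x < 0 : sgr_spec x (-1)
  | Sgr0 of x = 0 : sgr_spec x 0
  | SgrP of 0 < x : sgr_spec x 1.

Lemma sgr_cases (x : rat) : sgr_spec x (Num.sg x).
Proof. by case: sgrP => [->|?|?]; constructor. Qed.

Lemma counter_lstm_gates_nonzero : gates_nonzero counter_lstm.
Proof.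
move=> x a j; rewrite /slstm_run /lstm_run sign_state0.
have [s [d [c [k]]]] := run_from_sign_state x 0 0 0 0; rewrite /run_from => ->.
rewrite /= !aff_rowsE.
(* Only signs and the letter enter, so finitely many closed rationals remain to be checked. *)
case: j => [[|[|[|[|//]]]] jlt] /=;
  by case: (sgr_cases s) => _; case: (sgr_cases d) => _;
     case: (sgr_cases c) => _; case: (sgr_cases k) => _; case: a.
Qed.

Definition readout : 'rV[rat]_4 := \row_j [:: 2; 0; -1; -2]`_j.

Definition accepts (t : state 4) : bool := d1 readout (-1) (hidden t).

Lemma accepts_sign_state s d c k :
  accepts (sign_state s d c k) =
  (0 < 2 * Num.sg s - Num.sg c - 2 * Num.sg k - 1).
Proof.
rewrite /accepts /d1 !mxE !big_ord_recl big_ord0 !mxE /=.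
by congr (0 < _); ring.
Qed.

(* In a rejected state the counter [c] is unconstrained: either a negative [s]
   or a positive [k] outweighs it in the readout. *)
Definition rejected (t : state 4) : Prop :=
  exists s d c k, t = sign_state s d c k /\
    (s < 0 /\ 0 <= k \/ 0 < k).

Lemma step_ge0 z : 0 <= step z.
Proof. by rewrite /step; case: ifP. Qed.

(** A negative [s] persists because [2 * sg s] outweighs the letter, and [k] never decreases because
    its increments are values of [step]. *)
Lemma rejected_run_from y t : rejected t -> ~~ accepts (run_from t y).
Proof.
elim: y t => [|a y IHy] t [s [d [c [k [-> rej]]]]] /=; last first.
  apply: IHy; rewrite step_sign_state; do 4!eexists; split; first by [].
  case: rej => [[s0 k0]|k0]; [left | right]; last first.
    exact: ltr_wpDr (step_ge0 _) k0.
  split; last exact: addr_ge0 k0 (step_ge0 _).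
  by rewrite (ltr0_sg s0); case: a.
rewrite accepts_sign_state; case: rej => [[s0 k0]|k0].
  rewrite (ltr0_sg s0); case: (sgr_cases c) => _;
  case: (sgr_cases k) => [k1||] //; lra.
by rewrite (gtr0_sg k0); case: (sgr_cases c) => _; case: (sgr_cases s) => _.
Qed.

(** With [s] positive and [c = 0], the input gates of [c] and [k] both have negative arguments, so
    these cells stay 0. *)
Lemma accepted_run_from y s d :
  0 < s -> accepts (run_from (sign_state s d 0 0) y).
Proof.
elim: y s d => [|a y IHy] s d s0 /=.
  by rewrite accepts_sign_state (gtr0_sg s0) sgr0.
rewrite step_sign_state (gtr0_sg s0) sgr0.
have -> : step (2 * 0 - 2 * 1 + 1) = 0 by [].
have -> : step (2 * letter_sign a - 2 * Num.sg d + 2 * 0 - 5) = 0.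
  by case: a; case: (sgr_cases d).
by rewrite mul0r !addr0; apply: IHy; case: a.
Qed.

(** Here the last letter was b and [n.+1] a's are still unmatched. If the word ends now, the readout
    is 2 - 1 - 1 = 0, which is not accepted. *)
Lemma b_phase_run_from y n :
  accepts (run_from (sign_state 1 (-1) n.+1%:R 0) y) <->
  exists y', y = nseq n.+1 Lb ++ y'.
Proof.
elim: y n => [|[] y IHy] n /=.
- rewrite accepts_sign_state (gtr0_sg (ltr0Sn _ n)) sgr1 sgr0.
  by split=> // -[].
(* An a now follows a b while [c] is positive, so [k] becomes 1. *)
- split=> [acc|[]//]; exfalso; apply/negP: acc; apply: rejected_run_from.
  rewrite step_sign_state; do 4!eexists; split; first by [].
  by right; rewrite (gtr0_sg (ltr0Sn _ n)) sgrN sgr1.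
- rewrite step_sign_state (gtr0_sg (ltr0Sn _ n)) sgrN !sgr1 /=.
  have -> : step (2 * 1 - 2 * 1 + 1) = 1 by [].
  have -> : step (2 * -1 - 2 * -1 + 2 * 1 - 5) = 0 by [].
  rewrite mul1r addr0 -natr1 addrK.
  case: n => [|n].
    by split=> _; [exists y | apply: accepted_run_from].
  split=> [/IHy [y' ->]|[y' [yE]]]; first by exists y'.
  by apply/IHy; exists y'.
Qed.

(** Here [n.+1] a's and no b have been read; [j] further a's raise the number of b's required. *)
Lemma a_phase_run_from y n :
  accepts (run_from (sign_state 1 1 n.+1%:R 0) y) <->
  exists j y', y = nseq j La ++ nseq (n + j).+1 Lb ++ y'.
Proof.
elim: y n => [|a y IHy] n /=.
  rewrite accepts_sign_state (gtr0_sg (ltr0Sn _ n)) sgr1 sgr0.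
  by split=> // -[[|j] []].
rewrite step_sign_state (gtr0_sg (ltr0Sn _ n)) !sgr1.
have -> : step (2 * 1 - 2 * 1 + 1) = 1 by [].
have -> : step (2 * letter_sign a - 2 * 1 + 2 * 1 - 5) = 0 by case: a.
have -> : Num.sg (letter_sign a + 2 * 1) = 1 by case: a.
rewrite mul1r addr0; case: a => /=.
  rewrite natr1; split=> [/IHy [j [y' ->]]|[[|j] [y' []]] // yE].
    by exists j.+1, y'; rewrite addnS.
  by apply/IHy; exists j, y'; rewrite yE addnS.
(* The first b lowers the counter to [n]: at 0 acceptance is final, otherwise the b phase begins. *)
rewrite -natr1 addrK; case: n => [|n].
  split=> _; last exact: accepted_run_from.
  by exists 0, y.
split=> [/b_phase_run_from [y' ->]|[[|j] [y' []]] // ->].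
  by exists 0, y'; rewrite addn0.
by apply/b_phase_run_from; exists y'; rewrite addn0.
Qed.

Lemma accepts_counter_lstm x :
  accepts (slstm_run counter_lstm x) <-> anbn_prefix x.
Proof.
rewrite /slstm_run /lstm_run sign_state0; case: x => [|a y] /=.
  by rewrite accepts_sign_state !sgr0; split=> // -[[|n] [y []]].
rewrite step_sign_state !sgr0; case: a.
  (* A first a gives the cells (1, 1, 1, 0), the a phase with [n = 0]. *)
  have -> : step (2 * 0 - 2 * 0 + 1) = 1 by [].
  have -> : step (2 * letter_sign La - 2 * 0 + 2 * 0 - 5) = 0 by [].
  rewrite mulr0 mul1r addr0 !add0r sgr1.
  split=> [/(a_phase_run_from _ 0) [j [y' ->]]|[[|n] [y' []]] //= _ [->]].
    by exists j.+1, y'.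
  by apply/(a_phase_run_from _ 0); exists n, y'.
split=> [acc|[[|n] [y' []]]//]; exfalso; apply/negP: acc.
by apply: rejected_run_from; do 4!eexists; split; [by []|left].
Qed.

Theorem theorem14 : D1 (@sLSTM letter) anbn_prefix.
Proof.
exists 4, (fun x => hidden (slstm_run counter_lstm x)); split.
  exists 1, counter_lstm; split=> //; exact: counter_lstm_gates_nonzero.
by exists readout, (-1) => x; apply: accepts_counter_lstm.
Qed.
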